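(* Let $(A_1,A_2,B)$ define an unobservable planar bimodal linear system. If the system is controllable, then there is a feedback $F\in M_{1\times 2}(\mathbb{R})$ such that both subsystems $A_1+BF$ and $A_2+BF$ are stable.
   Context: A planar bimodal linear system is given by a triple $(A_1,A_2,B)\in M_2(\mathbb{R})\times M_2(\mathbb{R})\times M_{2\times 1}(\mathbb{R})$ such that $A_1$ and $A_2$ have the same second column, together with $C=(1\;\,0)$. It is observable if $\operatorname{rank}\begin{pmatrix}C\\ CA_i\end{pmatrix}=2$ for $i=1,2$, and unobservable otherwise; unobservability means exactly that the $(1,2)$ entry common to $A_1$ and $A_2$ is zero. The system with scalar input $u$ is $$\dot x(t)=A_1x(t)+Bu(t)\ \text{ if } Cx(t)\le 0,\qquad \dot x(t)=A_2x(t)+Bu(t)\ \text{ if } Cx(t)\ge 0,$$ which is well defined since $A_1x=A_2x$ whenever $Cx=0$. It is controllable if for every pair of states $x_0,x_f\in\mathbb{R}^2$ there exist a time $T_f>0$ and a locally integrable input $u:[0,T_f]\to\mathbb{R}$ such that the (absolutely continuous) solution with $x(0)=x_0$ satisfies $x(T_f)=x_f$. A matrix in $M_2(\mathbb{R})$ is stable if all its eigenvalues have negative real part (equivalently, it has negative trace and positive determinant). *)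

(* Defs.v *)
From mathcomp Require Import all_boot all_order all_algebra.
From mathcomp Require Import complex.
From mathcomp Require Import all_classical all_reals all_analysis.
Set Implicit Arguments.
Unset Strict Implicit.
Unset Printing Implicit Defensive.
Import Order.TTheory GRing.Theory Num.Theory.
Import numFieldNormedType.Exports.
Local Open Scope classical_set_scope.
Local Open Scope ring_scope.

Definition Cout (R : realType) : 'rV[R]_2 := delta_mx 0 0.

(* The indices 0 and 1 of 'I_2 stand for the first and second coordinates. *)
Definition same_second_column (R : realType) (A1 A2 : 'M[R]_2) : Prop :=
  col 1 A1 = col 1 A2.

Definition observability_mx (R : realType) (A : 'M[R]_2) : 'M[R]_(1 + 1, 2) :=
  col_mx (Cout R) (Cout R *m A).

Definition observable (R : realType) (A1 A2 : 'M[R]_2) : Prop :=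
  \rank (observability_mx A1) = 2%N /\ \rank (observability_mx A2) = 2%N.

Definition unobservable (R : realType) (A1 A2 : 'M[R]_2) : Prop :=
  ~ observable A1 A2.

(* Degenerate intervals (a i = b i) are allowed; they contribute 0 to both
   sums. *)
Definition absolutely_continuous (R : realType) (V : normedModType R)
    (p q : R) (f : R -> V) : Prop :=
  forall e : R, 0 < e -> exists2 d : R, 0 < d &
    forall (n : nat) (a b : 'I_n -> R),
      (forall i, p <= a i /\ a i <= b i /\ b i <= q) ->
      trivIset setT (fun i => `]a i, b i[%classic) ->
      \sum_(i < n) (b i - a i) < d ->
      \sum_(i < n) `|f (b i) - f (a i)| < e.

(* The states are functions on the whole line, but only their restriction to
   [0, T] matters: derivatives are taken at interior points. *)
Definition bimodal_solution (R : realType) (A1 A2 : 'M[R]_2) (B : 'cV[R]_2)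
    (T : R) (u : R -> R) (x : R -> 'cV[R]_2) : Prop :=
  absolutely_continuous 0 T x /\
  {ae (@lebesgue_measure R), forall t : R, `]0, T[%classic t ->
    ((Cout R *m x t) 0 0 <= 0 -> is_derive t 1 x (A1 *m x t + u t *: B)) /\
    (0 <= (Cout R *m x t) 0 0 -> is_derive t 1 x (A2 *m x t + u t *: B))}.

(* On the compact interval [0, T], local integrability is integrability. *)
Definition controllable (R : realType) (A1 A2 : 'M[R]_2) (B : 'cV[R]_2)
  : Prop :=
  forall x0 xf : 'cV[R]_2, exists (T : R) (u : R -> R) (x : R -> 'cV[R]_2),
    [/\ 0 < T,
        (@lebesgue_measure R).-integrable `[0, T] (EFin \o u),
        bimodal_solution A1 A2 B T u x,
        x 0 = x0 & x T = xf].

(* Eigenvalues are the complex ones, of the matrix mapped into R[i]. *)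
Definition stable (R : realType) (A : 'M[R]_2) : Prop :=
  forall z : complex R,
    eigenvalue (map_mx (real_complex R) A) z -> complex.Re z < 0.

(* Main.v *)
(* The states are (x1, x2), A_i = [[a_i, 0], [c_i, d]] and B = (b1, b2).  If
   b1 = 0, then x1' = a_i x1, so x1 cannot leave 0.  If b1 <> 0, then
   y = b1 x2 - b2 x1 satisfies y' = d y + m_i x1 where
   m_i = b1 c_i - a_i b2 + d b2.  If m_1 m_2 <= 0, then m_i x1 has a constant
   sign, so y, started at 0, stays on one side of 0.  Hence controllability
   gives m_1 m_2 > 0, and in the coordinates (x1, y) the feedback
   u = f x1 + g y turns A_i into [[a_i + b1 f, b1 g], [m_i, d]]: take b1 f very
   negative, then b1 g large of the sign opposite to that of the m_i.

   Both obstructions are instances of a comparison principle for an absolutely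
   continuous w: if w(0) >= 0 and w' >= K w almost everywhere on {w < 0}, then
   w >= 0. *)
Require Import Defs.
From mathcomp Require Import all_boot all_order all_algebra.
From mathcomp Require Import complex ring lra measurable_realfun.
From mathcomp Require Import all_classical all_reals all_analysis.
Set Implicit Arguments.
Unset Strict Implicit.
Unset Printing Implicit Defensive.
Import Order.TTheory GRing.Theory Num.Theory numFieldNormedType.Exports.
Local Open Scope classical_set_scope.
Local Open Scope ring_scope.

(** * Absolutely continuous functions and derivative bounds almost everywhere *)

(** Continuous induction. Let [t] be the supremum of the points of [[p, q]] where [S] holds. Some
    such point lies within [h] of [t] on its left, and [step] carries [S] from it across [t]; this
    reaches [q], or else [t + h / 2], which contradicts the choice of [t]. *)
Lemma interval_propagation (R : realType) (p q : R) (S : R -> Prop) :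
  p <= q -> S p ->
  (forall t, p <= t <= q -> exists2 h, 0 < h &
     forall s s', p <= s <= t -> t <= s' <= q -> t - h < s -> s' < t + h ->
       S s -> S s') ->
  S q.
Proof.
move=> lepq Sp step; pose E := [set s | p <= s <= q /\ S s].
have Ep : E p by split=> //; rewrite lexx.
have ubE : ubound E q by move=> s [/andP[]].
have supE : has_sup E by split; [exists p | exists q].
pose t := sup E.
have let_ : p <= t <= q by rewrite sup_upper_bound // ge_sup //; exists p.
have [h h0 Sh] := step _ let_.
have [s [/andP[ps sq] Ss] lts] := sup_adherent h0 supE.
have st : s <= t by apply: sup_upper_bound => //; split=> //; apply/andP.
have /andP[pt tq] := let_.
have Sh' s' : t <= s' <= q -> s' < t + h -> S s'.
  by move=> ts' hs'; apply: (Sh s s') => //; apply/andP.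
have [qh|hq] := ltP q (t + h); first by apply: Sh'; rewrite ?lexx ?andbT.
have Sth : S (t + h / 2) by apply: Sh'; lra.
suff : t + h / 2 <= t by lra.
by apply: sup_upper_bound => //; split=> //; lra.
Qed.

Lemma sum_length_le_measure (R : realType) (U : set R) n (a b : 'I_n -> R) :
  measurable U -> (forall i, a i <= b i) ->
  (forall i, `]a i, b i[%classic `<=` U) ->
  trivIset setT (fun i => `]a i, b i[%classic) ->
  ((\sum_(i < n) (b i - a i))%:E <= lebesgue_measure U)%E.
Proof.
move=> mU ab abU tI.
have mI : measurable (\big[setU/set0]_(i < n) `]a i, b i[%classic).
  by apply: bigsetU_measurable => i _; exact: measurable_itv.
have -> : (\sum_(i < n) (b i - a i))%:E =
    lebesgue_measure (\big[setU/set0]_(i < n) `]a i, b i[%classic).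
  rewrite (measure_semi_additive_ord lebesgue_measure) //.
  rewrite -sumEFin; apply: eq_bigr => i _.
  rewrite [RHS](lebesgue_measure_itv `]a i, b i[) /= lte_fin EFinB.
  have [//|ba] := ltP (a i) (b i).
  by rewrite -EFinB (@le_anti _ _ (a i) (b i)) ?ab ?subrr.
apply: le_measure; rewrite ?inE //.
by apply: (big_ind (fun A => A `<=` U)) => // A B AU BU x [/AU|/BU].
Qed.

Lemma absolutely_continuous_dist (R : realType) (V : normedModType R)
    (p q : R) (f : R -> V) : absolutely_continuous p q f ->
  forall e, 0 < e -> exists2 d : R, 0 < d & forall s t,
    p <= s -> s <= t -> t <= q -> t - s < d -> `|f t - f s| < e.
Proof.
move=> acf e e0; have [d d0 acd] := acf e e0; exists d => // s t ps st tq std.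
have := acd 1%N (fun=> s) (fun=> t); rewrite !big_ord1; apply=> //.
by move=> i j _ _ _; rewrite (ord1 i) (ord1 j).
Qed.

(** Near [t] the difference quotients based at [t] exceed [l - e] on both sides. Since [t] lies
    between [s] and [s'], the estimates on [[s, t]] and [[t, s']] add up. *)
Lemma is_derive_lower (R : realType) (f : R -> R) (t l e : R) :
  is_derive t 1 f l -> 0 < e -> exists2 h, 0 < h & forall s s',
    t - h < s -> s <= t -> t <= s' -> s' < t + h ->
    (l - e) * (s' - s) <= f s' - f s.
Proof.
move=> fl e0.
have /cvgrPdist_lt /(_ e e0) :
    h^-1 *: ((f \o shift t) (h *: (1 : R)) - f t) @[h --> 0^'] --> l.
  by case: fl => df <-; exact: df.
move=> /nbhs_ballP[h /= h0 Hh]; exists h => // s s' ths st ts' s'th.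
have slope k : `|k| < h -> k != 0 -> `|l - k^-1 * (f (k + t) - f t)| < e.
  move=> kh k0; have := Hh k; rewrite /ball /= sub0r normrN => /(_ kh k0).
  by rewrite /GRing.scale /= mulr1.
have right : (l - e) * (s' - t) <= f s' - f t.
  have [->|ts] := eqVneq s' t; first by rewrite !subrr mulr0.
  have k0 : 0 < s' - t by rewrite subr_gt0 lt_neqAle eq_sym ts.
  have /slope : `|s' - t| < h by rewrite gtr0_norm //; lra.
  rewrite gt_eqF // subrK ltr_norml => /(_ isT) /andP[_].
  rewrite ltrBlDr -ltrBlDl mulrC ltr_pdivlMr // => /ltW //.
have left : (l - e) * (t - s) <= f t - f s.
  have [->|ts] := eqVneq s t; first by rewrite !subrr mulr0.
  have k0 : 0 < t - s by rewrite subr_gt0 lt_neqAle ts.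
  have k0' : s - t != 0 by rewrite subr_eq0.
  have /slope : `|s - t| < h by rewrite distrC gtr0_norm //; lra.
  rewrite k0' subrK ltr_norml => /(_ isT) /andP[_].
  have -> : (s - t)^-1 * (f s - f t) = (f t - f s) / (t - s).
    by field; rewrite k0' gt_eqF.
  by rewrite ltrBlDr -ltrBlDl ltr_pdivlMr // => /ltW //.
by lra.
Qed.

(** Outer regularity, applied to a measurable null set [M] containing [N], bounds the measure of [U]
    minus [M], which is that of [U]. *)
Lemma null_set_open_cover (R : realType) (N : set R) (e : R) :
  (@lebesgue_measure R).-negligible N -> 0 < e ->
  exists U : set R, [/\ open U, N `<=` U & (lebesgue_measure U < e%:E)%E].
Proof.
move=> [M [mM M0 NM]] e0.
have [|U [oU MU Ue]] := @lebesgue_regularity_outer R M e mM _ e0.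
  by rewrite [X in (X < _)%E]M0 ltry.
exists U; split=> //; first exact: subset_trans NM MU.
have mU : measurable U by exact: open_measurable.
rewrite -(setDUK MU) measureU //; last 2 first.
- exact: measurableD.
- by rewrite setDE setICA setICr setI0.
by rewrite [X in (X + _)%E]M0 add0e.
Qed.

(* A null set containing the endpoints and the points where the derivative is
   not available is covered by an open set U of small measure.  A point
   outside U is crossed by means of the derivative, a point of U at the price
   of the oscillation of f on an interval contained in U, and absolute
   continuity makes the total price small. *)
Lemma ac_increment (R : realType) (f : R -> R) (p q c : R) :
  p <= q -> absolutely_continuous p q f ->
  {ae (@lebesgue_measure R), forall t, `]p, q[%classic t ->
     exists2 l, is_derive t 1 f l & c <= l} ->
  c * (q - p) <= f q - f p.
Proof.
move=> pq acf aef.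
(* The slack [e * (q - p + 2)] pays [e * (q - p)] for the slope [c - e], one [e] for the
   oscillations of [f] over the intervals in [U], and one for [|c|] times their total length. *)
suff H e : 0 < e -> c * (q - p) <= f q - f p + e * (q - p + 2).
  apply/ler_addgt0Pr => e e0; have qp2 : 0 < q - p + 2 by lra.
  have := H (e / (q - p + 2)); rewrite divr_gt0 // divfK ?gt_eqF //.
  exact.
move=> e0; have [d d0 acd] := acf e e0.
pose d' := Num.min d (e / (`|c| + 1)).
have c1 : 0 < `|c| + 1 by have := normr_ge0 c; lra.
have d'0 : 0 < d' by rewrite lt_min d0 divr_gt0.
pose N := (~` [set t | `]p, q[%classic t ->
     exists2 l, is_derive t 1 f l & c <= l]) `|` ([set p] `|` [set q]).
have N0 : (@lebesgue_measure R).-negligible N.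
  apply: negligibleU => //.
  by apply: negligibleU; apply/negligibleP => //; exact: lebesgue_measure_set1.
have [U [oU NU Ud]] := null_set_open_cover N0 d'0.
(* The property to propagate: the estimate holds up to [s], at the price of finitely many intervals
   in [U], listed from left to right. Crossing a point of [U] appends [[s, s']] to the list;
   crossing any other point leaves the list unchanged. *)
pose S s := exists n (a b : nat -> R),
  [/\ forall i, (i < n)%N ->
        [/\ p <= a i, a i <= b i, b i <= s & `]a i, b i[%classic `<=` U],
      forall i j, (i < j < n)%N -> b i <= a j &
      (c - e) * (s - p) <= f s - f p +
        \sum_(i < n) (`|f (b i) - f (a i)| + `|c| * (b i - a i))].
have Sq : S q.
  apply: (@interval_propagation R p q) => //.
    exists 0%N, (fun=> p), (fun=> p); split=> //.
    by rewrite big_ord0 !subrr mulr0 addr0.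
  move=> t /andP[pt tq].
  have [Ut|nUt] := pselect (U t).
    have /nbhs_ballP[h /= h0 hU] : nbhs t U by exact: open_nbhs_nbhs.
    exists h => // s s' /andP[ps st] /andP[ts' s'q] ths s'th.
    move=> [n [a [b [ab dis le_s]]]].
    exists n.+1, (fun i => if (i < n)%N then a i else s),
      (fun i => if (i < n)%N then b i else s'); split.
    - move=> i; rewrite ltnS => ilen; case: ifP => [/ab[pa aib bs aU]|_].
        by split=> //; lra.
      split=> //; first lra.
      move=> x /=; rewrite in_itv /= => /andP[sx xs']; apply: hU.
      by rewrite /ball /= ltr_norml; lra.
    - move=> i j /andP[ij]; rewrite ltnS => jn.
      rewrite (leq_trans ij jn); case: ifP => jn'.
        by apply: dis; rewrite ij.
      by have [] := ab i (leq_trans ij jn).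
    - rewrite big_ord_recr /= ltnn.
      under eq_bigr => i _ do rewrite ltn_ord.
      have := ler_norm (f s - f s'); rewrite distrC.
      have : c * (s' - s) <= `|c| * (s' - s).
        by rewrite ler_wpM2r ?ler_norm // subr_ge0; lra.
      have : 0 <= e * (s' - s) by apply: mulr_ge0; lra.
      by move: le_s; set X := \sum_(i < n) _; nra.
  have := contra_not (NU t) nUt; rewrite /N /= => /not_orP[/contrapT Dt].
  move=> /not_orP[/eqP tp /eqP tq'].
  have [|l fl cl] := Dt; first by rewrite in_itv /= !lt_neqAle eq_sym tp tq' pt.
  have [h h0 hf] := is_derive_lower fl e0; exists h => //.
  move=> s s' /andP[ps st] /andP[ts' s'q] ths s'th [n [a [b [ab dis le_s]]]].
  exists n, a, b; split=> // [i /ab[? ? ? ?]|]; first by split=> //; lra.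
  have := hf s s' ths st ts' s'th.
  have : (c - e) * (s' - s) <= (l - e) * (s' - s) by rewrite ler_wpM2r; lra.
  by move: le_s; set X := \sum_(i < n) _; nra.
have [n [a [b [ab dis le_q]]]] := Sq.
have tI : trivIset setT (fun i : 'I_n => `]a i, b i[%classic).
  suff lt_disj (i j : 'I_n) : (i < j)%N ->
      `]a i, b i[%classic `&` `]a j, b j[%classic = set0.
    move=> i j _ _ /set0P ne0; apply/eqP; apply: contraT => ij; move: ne0.
    have [lij|lji|/val_inj eij] := ltngtP i j.
    - by rewrite lt_disj ?eqxx.
    - by rewrite setIC lt_disj ?eqxx.
    - by rewrite eij eqxx in ij.
  move=> ij; apply/seteqP; split=> // x [] /=; rewrite !in_itv /=.
  move=> /andP[_ xb] /andP[ax _].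
  have : b i <= a j by apply: dis; rewrite ij ltn_ord.
  by lra.
have mU : measurable U by exact: open_measurable.
have sum_d' : \sum_(i < n) (b i - a i) < d'.
  rewrite -lte_fin; apply: le_lt_trans Ud.
  by apply: sum_length_le_measure => // i; have [] := ab i (ltn_ord i).
have sum_f : \sum_(i < n) `|f (b i) - f (a i)| < e.
  apply: (acd n a b) => //.
    by move=> i; have [] := ab i (ltn_ord i).
  by apply: lt_le_trans sum_d' _; rewrite ge_min lexx.
have sum_c : `|c| * \sum_(i < n) (b i - a i) <= e.
  have sum0 : 0 <= \sum_(i < n) (b i - a i).
    by apply: sumr_ge0 => i _; rewrite subr_ge0; have [] := ab i (ltn_ord i).
  have : \sum_(i < n) (b i - a i) < e / (`|c| + 1).
    by apply: lt_le_trans sum_d' _; rewrite ge_min lexx orbT.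
  by rewrite ltr_pdivlMr //; nra.
move: le_q; rewrite big_split /= -mulr_sumr; nra.
Qed.

Lemma absolutely_continuousS (R : realType) (V : normedModType R)
    (p q p' q' : R) (f : R -> V) : p <= p' -> q' <= q ->
  absolutely_continuous p q f -> absolutely_continuous p' q' f.
Proof.
move=> pp' q'q acf e /acf[d d0 acd]; exists d => // n a b ab.
by apply: acd => i; have [? [? ?]] := ab i; split=> //; [lra|split=> //; lra].
Qed.

(* Let s0 be the last time at which w is nonnegative.  If w q < 0 then w < 0
   after s0, and the infimum m of w over a short interval [s0, s0 + h] with
   K h <= 1/2 satisfies m >= K m h >= m / 2, so that m >= 0. *)
Lemma ac_comparison (R : realType) (w : R -> R) (p q K : R) :
  p <= q -> 0 <= K -> absolutely_continuous p q w -> 0 <= w p ->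
  {ae (@lebesgue_measure R), forall t, `]p, q[%classic t -> w t < 0 ->
     exists2 l, is_derive t 1 w l & K * w t <= l} ->
  0 <= w q.
Proof.
move=> pq K0 acw wp aew; rewrite leNgt; apply/negP => wq.
have w_dist := absolutely_continuous_dist acw.
pose E := [set t | p <= t <= q /\ 0 <= w t].
have Ep : E p by split=> //; rewrite lexx.
have supE : has_sup E by split; [exists p | exists q => s [/andP[]]].
pose s0 := sup E.
have ps0 : p <= s0 by apply: sup_upper_bound.
have s0q : s0 <= q by apply: ge_sup; [exists p | move=> s [/andP[]]].
have ws0 : 0 <= w s0.
  rewrite leNgt; apply/negP => ws0.
  have [|d d0 wd] := w_dist (- w s0); first lra.
  have [s [/andP[ps sq] ws] s0s] := sup_adherent d0 supE.
  have ss0 : s <= s0 by apply: sup_upper_bound => //; split=> //; apply/andP.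
  have := wd s s0 ps ss0 s0q; rewrite -/s0 in s0s.
  by rewrite ltr_norml => /(_ ltac:(lra)) /andP[]; lra.
have w_neg t : s0 < t -> t <= q -> w t < 0.
  move=> s0t tq; rewrite ltNge; apply/negP => wt.
  suff : t <= s0 by lra.
  by apply: sup_upper_bound => //; split=> //; lra.
have {}s0q : s0 < q.
  by rewrite lt_neqAle s0q andbT; apply/eqP => s0q'; rewrite s0q' in ws0; lra.
have [d d0 wd] := w_dist 1 ltr01.
pose K' := (2 * (K + 1))^-1.
have K'0 : 0 < K' by rewrite invr_gt0; lra.
have KK' : K * K' <= 1 / 2.
  by rewrite /K' ler_pdivrMr; lra.
(* The bound [d / 2] keeps [w] above -1 on [[s0, T]], so that its infimum is finite; the bound [K']
   gives [K * (T - s0) <= 1 / 2]. *)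
pose T := Num.min q (s0 + Num.min (d / 2) K').
have Tq : T <= q by rewrite ge_min lexx.
have Td : T - s0 < d.
  suff : T <= s0 + d / 2 by lra.
  by rewrite ge_min lerD2l ge_min lexx orbT.
have TK : T - s0 <= K'.
  suff : T <= s0 + K' by lra.
  by rewrite ge_min lerD2l [X in _ || X]ge_min lexx !orbT.
have s0T : s0 < T.
  by rewrite lt_min s0q ltrDl lt_min K'0 divr_gt0.
pose W := [set w t | t in `[s0, T]].
have W0 : W !=set0 by exists (w T), T => //=; rewrite in_itv /= lexx ltW.
have lbW : has_lbound W.
  exists (-1) => _ [t + <-]; rewrite /= in_itv /= => /andP[s0t tT].
  have := wd s0 t ps0 s0t; rewrite ltr_norml => /(_ ltac:(lra) ltac:(lra)).
  by case/andP; lra.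
have m0 : inf W <= 0.
  apply: le_trans (ltW (w_neg T s0T Tq)); apply: ge_inf => //.
  by exists T => //=; rewrite in_itv /= lexx ltW.
have half t : s0 <= t -> t <= T -> inf W / 2 <= w t.
  move=> s0t tT; have : K * inf W * (t - s0) <= w t - w s0.
    apply: ac_increment => //.
      by apply: absolutely_continuousS acw => //; lra.
    apply: (@filterS _ _ (ae_filter_ringOfSetsType lebesgue_measure) _ _ _ aew).
    move=> r; rewrite /= !in_itv /= => aer /andP[s0r rt].
    have [| |l wl Kl] := aer.
    - by apply/andP; lra.
    - by apply: w_neg; lra.
    exists l => //; apply: le_trans Kl; rewrite ler_wpM2l //.
    by apply: ge_inf => //; exists r => //=; rewrite in_itv /=; lra.
  have : K * (t - s0) <= 1 / 2.
    by apply: le_trans KK'; rewrite ler_wpM2l //; lra.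
  by nra.
have : inf W / 2 <= inf W.
  apply: lb_le_inf => // _ [t + <-]; rewrite /= in_itv /= => /andP[s0t tT].
  exact: half.
have := half T (ltW s0T) (lexx T); have := w_neg T s0T Tq; lra.
Qed.

(** * Two-by-two matrices: stability, observability and the choice of the feedback *)

Lemma mulmx2E (R : pzRingType) m n (A : 'M[R]_(m, 2)) (B : 'M[R]_(2, n)) i j :
  (A *m B) i j = A i 0 * B 0 j + A i 1 * B 1 j.
Proof.
rewrite mxE !big_ord_recl big_ord0 addr0 /=.
by congr (_ + A _ _ * B _ _); apply/val_inj.
Qed.

Lemma det2E (R : comPzRingType) (A : 'M[R]_2) :
  \det A = A 0 0 * A 1 1 - A 0 1 * A 1 0.
Proof.
rewrite (expand_det_row _ 0) !big_ord_recl big_ord0 addr0 /=.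
rewrite /cofactor !det_mx11 !mxE /= expr0 expr1 !mul1r mulN1r mulrN.
by congr (A _ _ * A _ _ - A _ _ * A _ _); apply/val_inj.
Qed.

(** An eigenvalue x + iy is a root of the characteristic polynomial. If x >= 0, the imaginary part
    (2x - tr) y = 0 forces y = 0, and then the real part x^2 - tr x + det is positive. *)
Lemma stable_trace_det (R : realType) (A : 'M[R]_2) :
  A 0 0 + A 1 1 < 0 -> 0 < A 0 0 * A 1 1 - A 0 1 * A 1 0 -> stable A.
Proof.
pose c := real_complex R.
move=> trA detA z /eigenvalueP[v /rowP vA v0].
have := vA 0; have := vA 1; rewrite !mulmx2E !mxE -/c.
set a := v 0 0; set b := v 0 1 => Eb Ea.
have chi : z ^+ 2 - (c (A 0 0) + c (A 1 1)) * z +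
    (c (A 0 0) * c (A 1 1) - c (A 0 1) * c (A 1 0)) = 0.
  (* Multiplying the eigenvector equation by the adjugate of z - A shows that [chi] kills both
     coordinates of [v]. *)
  set chi := LHS.
  have ca : chi * a = 0.
    have -> : chi * a =
        (z - c (A 1 1)) * (z * a - (a * c (A 0 0) + b * c (A 1 0))) +
        c (A 1 0) * (z * b - (a * c (A 0 1) + b * c (A 1 1))).
      by rewrite /chi; ring.
    by rewrite Ea Eb !subrr !mulr0 addr0.
  have cb : chi * b = 0.
    have -> : chi * b =
        (z - c (A 0 0)) * (z * b - (a * c (A 0 1) + b * c (A 1 1))) +
        c (A 0 1) * (z * a - (a * c (A 0 0) + b * c (A 1 0))).
      by rewrite /chi; ring.
    by rewrite Ea Eb !subrr !mulr0 addr0.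
  apply: contraNeq v0 => chi0; apply/eqP/rowP => j; rewrite mxE.
  move: ca cb => /eqP; rewrite mulf_eq0 (negbTE chi0) /= => /eqP a0.
  move=> /eqP; rewrite mulf_eq0 (negbTE chi0) /= => /eqP b0.
  case: j => [[|[|//]] j2]; [rewrite -[RHS]a0|rewrite -[RHS]b0];
  by congr (v _ _); apply/val_inj.
move: chi; case: z {vA Ea Eb} => x y.
rewrite /c expr2; simpc.
move=> [Re0 Im0] /=; rewrite ltNge; apply/negP => x0.
have y0 : y = 0.
  apply/eqP; have : (2 * x - (A 0 0 + A 1 1)) * y == 0 by apply/eqP; lra.
  by rewrite mulf_eq0 => /orP[/eqP|//]; lra.
have : (A 0 0 + A 1 1) * x <= 0 by rewrite nmulr_rle0.
by rewrite y0 in Re0; nra.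
Qed.

(** The observability matrix is triangular with diagonal 1, [A 0 1]. The contrapositive extracts
    from unobservability that this entry vanishes. *)
Lemma observable_entry (R : realType) (A : 'M[R]_2) :
  A 0 1 != 0 -> \rank (observability_mx A) = 2%N.
Proof.
move=> A01; apply: (@mxrank_unit R 2); rewrite unitmxE det2E /observability_mx.
have E (i j : 'I_2) : col_mx (Cout R) (Cout R *m A) i j =
    if i == 0 then (j == 0)%:R else A 0 j.
  have -> : Cout R *m A = row 0 A by rewrite /Cout -rowE.
  case: i => [[|[|//]] i2].
  - rewrite (_ : Ordinal i2 = @lshift 1 1 0) ?col_mxEu ?mxE ?eqxx //.
    exact/val_inj.
  - rewrite (_ : Ordinal i2 = @rshift 1 1 0) ?col_mxEd ?mxE //.
    exact/val_inj.
by rewrite unitfE !E /= mul0r subr0 mul1r.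
Qed.

Lemma stabilizing_feedback (R : realType) (A1 A2 : 'M[R]_2) (B : 'cV[R]_2) :
  A1 0 1 = 0 -> A2 0 1 = 0 -> A1 1 1 = A2 1 1 -> B 0 0 != 0 ->
  0 < (B 0 0 * A1 1 0 - A1 0 0 * B 1 0 + A1 1 1 * B 1 0) *
      (B 0 0 * A2 1 0 - A2 0 0 * B 1 0 + A1 1 1 * B 1 0) ->
  exists F : 'rV[R]_2, stable (A1 + B *m F) /\ stable (A2 + B *m F).
Proof.
set b1 := B 0 0; set b2 := B 1 0; set d := A1 1 1.
set m1 := _ + _; set m2 := _ + _ => A101 A201 d12 b10 m12.
have [s [s1 s2]] : exists s, s * m1 < 0 /\ s * m2 < 0.
  by exists (- (m1 + m2)); split; nra.
(* [k] will be [b1 * f], which makes both traces at most -1. The determinants will be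
   [n1 - r * (s * m1)] and [n2 - r * (s * m2)]; each summand of [r] makes one of them positive and
   only increases the other. *)
pose k := - (`|A1 0 0| + `|A2 0 0| + `|d| + 1).
pose n1 := d * (A1 0 0 + k); pose n2 := d * (A2 0 0 + k).
pose r := (`|n1| + 1) / - (s * m1) + (`|n2| + 1) / - (s * m2).
have r1 : r * (s * m1) < n1.
  rewrite /r mulrDl invrN mulrN mulNr divfK ?lt_eqF //.
  have : (`|n2| + 1) / - (s * m2) * (s * m1) < 0.
    by rewrite pmulr_rlt0 // divr_gt0 ?ltr_wpDl // oppr_gt0.
  by have := ler_norm (- n1); rewrite normrN; lra.
have r2 : r * (s * m2) < n2.
  rewrite /r mulrDl (invrN (s * m2)) (mulrN _ (_^-1)) (mulNr _ (s * m2)).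
  rewrite divfK ?lt_eqF //.
  have : (`|n1| + 1) / - (s * m1) * (s * m2) < 0.
    by rewrite pmulr_rlt0 // divr_gt0 ?ltr_wpDl // oppr_gt0.
  by have := ler_norm (- n2); rewrite normrN; lra.
pose f := k / b1; pose g := r * s / b1.
(* This row is f x1 + g y with y = b1 x2 - b2 x1, in the original coordinates. *)
exists (\row_j if j == 0 then f - g * b2 else g * b1).
have kb1 : b1 * f = k by rewrite /f; field.
have gb1 : b1 * g = r * s by rewrite /g; field.
have ? := ler_norm (A1 0 0); have ? := ler_norm (A2 0 0); have ? := ler_norm d.
have ? := normr_ge0 (A1 0 0); have ? := normr_ge0 (A2 0 0).
have ? := normr_ge0 d.
split; apply: stable_trace_det.
- rewrite !mxE !big_ord1 !mxE /= -/b1 -/b2 -/d.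
  have -> : A1 0 0 + b1 * (f - g * b2) + (d + b2 * (g * b1)) =
      A1 0 0 + d + b1 * f by ring.
  by rewrite kb1 /k; lra.
- rewrite !mxE !big_ord1 !mxE /= -/b1 -/b2 -/d A101.
  set D := (X in 0 < X).
  have -> : D = d * (A1 0 0 + b1 * f) - (b1 * g) * m1 by rewrite /D /m1; ring.
  by rewrite kb1 gb1 -mulrA subr_gt0.
- rewrite !mxE !big_ord1 !mxE /= -d12 -/b1 -/b2 -/d.
  have -> : A2 0 0 + b1 * (f - g * b2) + (d + b2 * (g * b1)) =
      A2 0 0 + d + b1 * f by ring.
  by rewrite kb1 /k; lra.
- rewrite !mxE !big_ord1 !mxE /= -d12 -/b1 -/b2 -/d A201.
  set D := (X in 0 < X).
  have -> : D = d * (A2 0 0 + b1 * f) - (b1 * g) * m2 by rewrite /D /m2; ring.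
  by rewrite kb1 gb1 -mulrA subr_gt0.
Qed.

(** * Linear forms along trajectories, and half-planes that cannot be entered *)

Lemma mx_coord_le_norm (R : realType) m n (M : 'M[R]_(m, n)) i j :
  `|M i j| <= `|M|.
Proof.
rewrite [leRHS]mx_normrE.
exact: (le_bigmax 0 (fun ij : 'I_m * 'I_n => `|M ij.1 ij.2|) (i, j)).
Qed.

Definition row_form (R : realType) (g : 'rV[R]_2) (v : 'cV[R]_2) : R :=
  (g *m v) 0 0.

Lemma row_form_is_derive (R : realType) (g : 'rV[R]_2)
    (x : R -> 'cV[R]_2) (t : R) (v : 'cV[R]_2) :
  is_derive t 1 x v -> is_derive t 1 (row_form g \o x) (row_form g v).
Proof.
move=> xv.
have xcvg : h^-1 *: ((x \o shift t) (h *: (1 : R)) - x t) @[h --> 0^'] --> v.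
  by case: xv => dx <-; exact: dx.
have formcvg :
    h^-1 *: (((row_form g \o x) \o shift t) (h *: (1 : R)) -
             (row_form g \o x) t) @[h --> 0^'] --> row_form g v.
  have coord i : ((h^-1 *: ((x \o shift t) (h *: (1 : R)) - x t)) i 0 : R)
      @[h --> 0^'] --> (v i 0 : R).
    apply: (cvg_comp _ (fun M : 'cV[R]_2 => M i 0) xcvg).
    exact: coord_continuous.
  rewrite /row_form mulmx2E.
  under eq_fun => h.
    have -> : h^-1 *: (((row_form g \o x) \o shift t) (h *: (1 : R)) -
                       (row_form g \o x) t) =
      g 0 0 * ((h^-1 *: ((x \o shift t) (h *: (1 : R)) - x t)) 0 0) +
      g 0 1 * ((h^-1 *: ((x \o shift t) (h *: (1 : R)) - x t)) 1 0).
      by rewrite /row_form /= !mulmx2E !mxE /GRing.scale /=; ring.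
    over.
  by apply: cvgD; apply: cvgMr.
apply: DeriveDef; first by apply/cvg_ex; exists (row_form g v).
exact: cvg_lim.
Qed.

Lemma row_form_bound (R : realType) (g : 'rV[R]_2) (v : 'cV[R]_2) :
  `|row_form g v| <= (`|g 0 0| + `|g 0 1|) * `|v|.
Proof.
rewrite /row_form mulmx2E; apply: le_trans (ler_normD _ _) _.
rewrite !normrM mulrDl lerD // ler_wpM2l //.
  exact: mx_coord_le_norm.
exact: mx_coord_le_norm.
Qed.

Lemma row_form_absolutely_continuous (R : realType) (g : 'rV[R]_2)
    (x : R -> 'cV[R]_2) (p q : R) :
  absolutely_continuous p q x -> absolutely_continuous p q (row_form g \o x).
Proof.
(* The form is Lipschitz; the added 1 keeps [C] positive even when [g] is zero. *)
move=> acx e e0; pose C := `|g 0 0| + `|g 0 1| + 1.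
have C0 : 0 < C by rewrite ltr_wpDl // addr_ge0.
have [|d d0 acd] := acx (e / C); first by rewrite divr_gt0.
exists d => // n a b ab tI abd.
have := acd n a b ab tI abd; rewrite ltr_pdivlMr // mulrC.
apply: le_lt_trans; rewrite mulr_sumr; apply: ler_sum => i _.
have -> : (row_form g \o x) (b i) - (row_form g \o x) (a i) =
    row_form g (x (b i) - x (a i)).
  by rewrite /row_form /= mulmxBr !mxE.
by apply: le_trans (row_form_bound _ _) _; rewrite ler_wpM2r // /C lerDl.
Qed.

(** The bounds hold for every input value, so [ac_comparison] applies to [g] along any trajectory
    starting at 0: it never reaches the half-plane where the form is negative, which contains
    [- g^T] as [g] is nonzero. *)
Lemma barrier_not_controllable (R : realType) (g : 'rV[R]_2)
    (A1 A2 : 'M[R]_2) (B : 'cV[R]_2) (K : R) :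
  g != 0 -> 0 <= K ->
  (forall (v : 'cV[R]_2) (u : R), v 0 0 <= 0 -> row_form g v < 0 ->
     K * row_form g v <= row_form g (A1 *m v + u *: B)) ->
  (forall (v : 'cV[R]_2) (u : R), 0 <= v 0 0 -> row_form g v < 0 ->
     K * row_form g v <= row_form g (A2 *m v + u *: B)) ->
  ~ controllable A1 A2 B.
Proof.
move=> g0 K0 H1 H2 ctrl.
have [xf xf0] : exists v, row_form g v < 0.
  exists (- g^T); rewrite /row_form mulmx2E !mxE.
  suff : 0 < g 0 0 ^+ 2 + g 0 1 ^+ 2 by lra.
  rewrite lt_neqAle addr_ge0 ?sqr_ge0 // andbT eq_sym paddr_eq0 ?sqr_ge0 //.
  rewrite !sqrf_eq0; apply: contra g0 => /andP[/eqP g00 /eqP g01].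
  apply/eqP/matrixP => i j; rewrite (ord1 i) mxE.
  case: j => [[|[|//]] j2]; [rewrite -[RHS]g00|rewrite -[RHS]g01];
  by congr (g _ _); apply/val_inj.
have [T [u [x [T0 _ [acx aex] x0 xT]]]] := ctrl 0 xf.
suff : 0 <= (row_form g \o x) T by rewrite /= xT; lra.
apply: (@ac_comparison R _ 0 T K) => //; first exact: ltW.
- exact: row_form_absolutely_continuous.
- by rewrite /= x0 /row_form mulmx0 mxE.
have C00 (v : 'cV[R]_2) : (Cout R *m v) 0 0 = v 0 0.
  by rewrite /Cout -rowE mxE.
apply: (@filterS _ _ (ae_filter_ringOfSetsType lebesgue_measure) _ _ _ aex).
move=> t /= aet /aet[]; rewrite C00 => d1 d2 form0.
have [xt|/ltW xt] := leP (x t 0 0) 0.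
  exists (row_form g (A1 *m x t + u t *: B)); last exact: H1.
  exact/row_form_is_derive/d1.
exists (row_form g (A2 *m x t + u t *: B)); last exact: H2.
exact/row_form_is_derive/d2.
Qed.

(** * The two obstructions to controllability, and the remaining case *)

Lemma vector_fieldE (R : realType) (A : 'M[R]_2) (B v : 'cV[R]_2) (u : R) i :
  (A *m v + u *: B) i 0 = A i 0 * v 0 0 + A i 1 * v 1 0 + u * B i 0.
Proof. by rewrite mxE mulmx2E mxE. Qed.

Unset Implicit Arguments.

Theorem theorem11 (R : realType) (A1 A2 : 'M[R]_2) (B : 'cV[R]_2)
    (hcol : same_second_column A1 A2)
    (hunobs : unobservable A1 A2)
    (hctrl : controllable A1 A2 B) :
  exists F : 'rV[R]_2, stable (A1 + B *m F) /\ stable (A2 + B *m F).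
Proof.
have col12 i : A1 i 1 = A2 i 1 by move/colP/(_ i): hcol; rewrite !mxE.
have A201 : A2 0 1 = 0.
  apply/eqP; apply: contra_notT hunobs => A201.
  by split; apply: observable_entry; rewrite ?col12.
have A101 : A1 0 1 = 0 by rewrite col12.
(* If b1 = 0 the barrier is x1 itself. Only the first mode matters where x1 < 0, and there a_1 x1 >=
   |a_1| x1; the condition on the second mode is vacuous. *)
have [B0|B0] := eqVneq (B 0 0) 0.
  exfalso.
  apply: (@barrier_not_controllable R (Cout R) A1 A2 B `|A1 0 0|) hctrl.
  - by apply/eqP => /matrixP/(_ 0 0)/eqP; rewrite !mxE oner_eq0.
  - by [].
  - move=> v u _; rewrite /row_form !mulmx2E !vector_fieldE !mxE A101 B0 /= => v0.
    by have := ler_norm (A1 0 0); nra.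
  - move=> v u v0; rewrite /row_form !mulmx2E !mxE /=; lra.
have [m12|m12] := ltP 0 ((B 0 0 * A1 1 0 - A1 0 0 * B 1 0 + A1 1 1 * B 1 0) *
                         (B 0 0 * A2 1 0 - A2 0 0 * B 1 0 + A1 1 1 * B 1 0)).
  exact: stabilizing_feedback.
exfalso; move: m12; set m1 := _ + _; set m2 := _ + _ => m12.
(* With this sign, s m_i x1 >= 0 in the half-plane of each mode: x1 <= 0 for the first, x1 >= 0 for
   the second. *)
have [s s0 [sm1 sm2]] : exists2 s : R, s != 0 & s * m1 <= 0 /\ 0 <= s * m2.
  have [m1_0|m1_0] := leP m1 0; have [m2_0|m2_0] := leP 0 m2.
  - by exists 1; rewrite ?oner_eq0 // !mul1r.
  - exists (-1); rewrite ?oppr_eq0 ?oner_eq0 // !mulN1r oppr_le0 oppr_ge0.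
    by rewrite (ltW m2_0); split=> //; rewrite -(nmulr_lle0 _ m2_0).
  - exists (-1); rewrite ?oppr_eq0 ?oner_eq0 // !mulN1r oppr_le0 oppr_ge0.
    by rewrite (ltW m1_0); split=> //; rewrite -(pmulr_rle0 _ m1_0).
  - exists (-1); rewrite ?oppr_eq0 ?oner_eq0 // !mulN1r oppr_le0 oppr_ge0.
    by rewrite !ltW.
(* The form is s (b1 x2 - b2 x1). It vanishes on [B], so the input drops out of its derivative. *)
pose g : 'rV[R]_2 := \row_j (if j == 0 then - s * B 1 0 else s * B 0 0).
apply: (@barrier_not_controllable R g A1 A2 B `|A1 1 1|) hctrl.
- apply: contra_neq (mulf_neq0 s0 B0) => /matrixP/(_ 0 1).
  by rewrite !mxE.
- by [].
- move=> v u v0; rewrite /row_form !mulmx2E !vector_fieldE !mxE A101 /= => form0.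
  set y := (Y in _ * Y <= _) in form0 *.
  (* The first term is at least [|A1 1 1| * y] because [y < 0], and the second is nonnegative by the
     choice of [s]. *)
  rewrite [leRHS](_ : _ = A1 1 1 * y + s * m1 * v 0 0); last first.
    by rewrite /y /m1; ring.
  rewrite -[leLHS]addr0; apply: lerD; last exact: mulr_le0.
  by apply: ler_wnM2r; [exact: ltW|exact: ler_norm].
- move=> v u v0; rewrite /row_form !mulmx2E !vector_fieldE !mxE A201 -col12 /=.
  move=> form0.
  set y := (Y in _ * Y <= _) in form0 *.
  rewrite [leRHS](_ : _ = A1 1 1 * y + s * m2 * v 0 0); last first.
    by rewrite /y /m2; ring.
  rewrite -[leLHS]addr0; apply: lerD; last exact: mulr_ge0.
  by apply: ler_wnM2r; [exact: ltW|exact: ler_norm].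
Qed.
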